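(* Let $A$ be a Jordan algebra. If $A$ has no nilpotent elements, then the following two conditions are equivalent: (A2) for every subset $S\subseteq A_+$ there exists an idempotent $e\in A$ such that $S^\perp=U_e(A)$; (B2) for every subset $S\subseteq A$ there exists an idempotent $e\in A$ such that ${}^\perp S_+=U_e(A)_+$.
   Context: Jordan algebras are over a field of characteristic different from $2$ and are not assumed unital. For a Jordan algebra $A$ put $A_+=\{a^2: a\in A\}$, $U_a b=2(ab)a-a^2b$, $U_a(A)=\{U_ax : x\in A\}$ and $U_a(A)_+=U_a(A)\cap A_+$. For a subset $S\subseteq A$ put $S^\perp=\{a\in A: U_a x=0 \text{ for all } x\in S\}$, ${}^\perp S=\{x\in A: U_a x=0 \text{ for all } a\in S\}$ and ${}^\perp S_+={}^\perp S\cap A_+$. An idempotent is an element $e$ with $e^2=e$. ''No nilpotent elements'' means that $0$ is the only element $a$ with $a^n=0$ for some $n\ge 1$. *)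

(* Defs.v *)
From HB Require Import structures.
From mathcomp Require Import all_boot all_order all_algebra.
From mathcomp Require Import classical_sets.

Set Implicit Arguments.
Unset Strict Implicit.
Unset Printing Implicit Defensive.

Import GRing.Theory.
Local Open Scope classical_set_scope.
Local Open Scope ring_scope.

(* The carrier is an arbitrary module, of possibly infinite dimension, and no
   unit is required.  The hypothesis that F has characteristic different from
   2 is not part of the structure. *)
HB.mixin Record Lmodule_isJordan (F : fieldType) A of GRing.Lmodule F A := {
  jmul : A -> A -> A;
  jmul_bilinear : bilinear_for *:%R *:%R jmul;
  jmulC : commutative jmul;
  jmul_jordan : forall a b : A,
    jmul (jmul (jmul a a) b) a = jmul (jmul a a) (jmul b a)
}.

#[short(type="jordanType")]
HB.structure Definition Jordan (F : fieldType) :=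
  {A of GRing.Lmodule F A & Lmodule_isJordan F A}.

Notation "a ∘ b" := (jmul a b) (at level 40, left associativity) : ring_scope.

HB.instance Definition _ (F : fieldType) (A : jordanType F) :=
  bilinear_isBilinear.Build F A A A *:%R *:%R (@jmul F A) jmul_bilinear.

Section JordanDefs.
Variables (F : fieldType) (A : jordanType F).
Implicit Types (a b e x : A) (S : set A).

(* The power a^n is only meaningful for n >= 1, as A need not have a unit;
   the value at n = 0 is the junk value 0.  The bracketing is
   a ∘ (a ∘ (... ∘ a)). *)
Definition jpow a (n : nat) : A := iterop n (@jmul F A) a 0.

Definition no_nilpotents := forall a n, (0 < n)%N -> jpow a n = 0 -> a = 0.

Definition jidempotent e := e ∘ e = e.

Definition jU a b : A := ((a ∘ b) ∘ a) *+ 2 - (a ∘ a) ∘ b.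

Definition jsquares : set A := range (fun a => a ∘ a).

Definition jUrange a : set A := range (jU a).

Definition jUrange_pos a : set A := jUrange a `&` jsquares.

(* S^⊥ : the elements a with U_a vanishing on S. *)
Definition rperp S : set A := [set a | forall x, S x -> jU a x = 0].

(* ⊥S : the elements killed by U_a for every a in S. *)
Definition lperp S : set A := [set x | forall a, S a -> jU a x = 0].

Definition lperp_pos S : set A := lperp S `&` jsquares.

End JordanDefs.

Arguments no_nilpotents {F} A.
Arguments jsquares {F} A.

(* Main.v *)
(* The identities (U_a b)^2 = U_a U_b a^2 and U_{a^2} = U_a U_a show, in the
   absence of nilpotents, that the conditions U_a b^2 = 0, U_b a^2 = 0 and
   U_{a^2} b^2 = 0 are equivalent.  Hence, for a set T with set of squares T^2,
   ⊥T_+ consists of the squares lying in (T^2)^⊥, and a lies in (T^2)^⊥ iff a^2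
   lies in ⊥T_+.  The first fact gives (A2) => (B2); the second gives the
   converse, because a^2 lies in U_e(A) iff a does. *)

Require Import Defs.
From mathcomp Require Import all_boot all_order all_algebra.
From mathcomp Require Import classical_sets.

Import GRing.Theory.
Local Open Scope classical_set_scope.
Local Open Scope ring_scope.

(** * Normal forms of commutative nonassociative polynomials over the integers *)

Inductive jmon := JVar of nat | JNode of jmon & jmon.

Inductive jexp :=
  | JX of nat | J0 | JAdd of jexp & jexp | JOpp of jexp
  | JMuln of jexp & nat | JMul of jexp & jexp.

Fixpoint jmon_eqb t u :=
  match t, u with
  | JVar m, JVar n => m == n
  | JNode t1 t2, JNode u1 u2 => jmon_eqb t1 u1 && jmon_eqb t2 u2
  | _, _ => false
  end.

Fixpoint jmon_leb t u :=
  match t, u with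
  | JVar m, JVar n => (m <= n)%N
  | JVar _, JNode _ _ => true
  | JNode _ _, JVar _ => false
  | JNode t1 t2, JNode u1 u2 =>
    if jmon_eqb t1 u1 then jmon_leb t2 u2 else jmon_leb t1 u1
  end.

(** Ordering the two factors gives products that agree up to commutativity the same tree. *)
Definition jnode t u := if jmon_leb t u then JNode t u else JNode u t.

Fixpoint jinsert (c : int) t (p : seq (int * jmon)) :=
  if p is (d, u) :: q then
    if jmon_eqb t u then (c + d, u) :: q else (d, u) :: jinsert c t q
  else [:: (c, t)].

Definition jadd p q := foldr (fun ct r => jinsert ct.1 ct.2 r) q p.

Definition jscale (c : int) (p : seq (int * jmon)) :=
  [seq (c * dt.1, dt.2) | dt <- p].

Definition jprod (p q : seq (int * jmon)) :=
  foldr (fun ct r => jadd [seq (ct.1 * du.1, jnode ct.2 du.2) | du <- q] r)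
    [::] p.

Fixpoint jnorm e :=
  match e with
  | JX n => [:: (1, JVar n)]
  | J0 => [::]
  | JAdd e1 e2 => jadd (jnorm e1) (jnorm e2)
  | JOpp e1 => jscale (-1) (jnorm e1)
  | JMuln e1 n => jscale n%:Z (jnorm e1)
  | JMul e1 e2 => jprod (jnorm e1) (jnorm e2)
  end.

(** * Bilinearity and soundness of the normal form *)

Section Bilinearity.
Variables (F : fieldType) (A : jordanType F).
Implicit Types (a b c : A).

Lemma jmulDl a b c : (a + b) ∘ c = a ∘ c + b ∘ c.
Proof. by rewrite linearDl. Qed.

Lemma jmulDr a b c : c ∘ (a + b) = c ∘ a + c ∘ b.
Proof. by rewrite linearDr. Qed.

Lemma jmulMzl (m : int) a b : (a *~ m) ∘ b = (a ∘ b) *~ m.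
Proof. exact: (raddfMz (applyr (@jmul F A) b)). Qed.

Lemma jmulMzr (m : int) a b : a ∘ (b *~ m) = (a ∘ b) *~ m.
Proof. by rewrite jmulC jmulMzl jmulC. Qed.

Lemma jmul0 a : a ∘ 0 = 0. Proof. by rewrite linear0r. Qed.

Lemma jmul0l a : 0 ∘ a = 0. Proof. by rewrite linear0l. Qed.

Fixpoint jmon_eval (env : seq A) t : A :=
  match t with
  | JVar n => env`_n
  | JNode t1 t2 => jmon_eval env t1 ∘ jmon_eval env t2
  end.

Fixpoint jexp_eval (env : seq A) e : A :=
  match e with
  | JX n => env`_n
  | J0 => 0
  | JAdd e1 e2 => jexp_eval env e1 + jexp_eval env e2
  | JOpp e1 => - jexp_eval env e1
  | JMuln e1 n => jexp_eval env e1 *+ n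
  | JMul e1 e2 => jexp_eval env e1 ∘ jexp_eval env e2
  end.

Definition jpoly_eval (env : seq A) (p : seq (int * jmon)) : A :=
  foldr (fun ct x => jmon_eval env ct.2 *~ ct.1 + x) 0 p.

Lemma jmon_eqbP t u : jmon_eqb t u -> t = u.
Proof.
elim: t u => [m|t1 IH1 t2 IH2] [n|u1 u2] //=; first by move/eqP->.
by case/andP=> /IH1-> /IH2->.
Qed.

Lemma jpoly_eval_insert env (c : int) t p :
  jpoly_eval env (jinsert c t p) = jmon_eval env t *~ c + jpoly_eval env p.
Proof.
elim: p => [|[d u] p IH] //=; case: ifP => [/jmon_eqbP->|_] /=.
  by rewrite mulrzDr addrA.
by rewrite IH addrCA.
Qed.

Lemma jpoly_eval_add env p q :
  jpoly_eval env (jadd p q) = jpoly_eval env p + jpoly_eval env q.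
Proof.
elim: p => [|[c t] p IH] /=; first by rewrite add0r.
by rewrite jpoly_eval_insert IH addrA.
Qed.

Lemma jpoly_eval_scale env (c : int) p :
  jpoly_eval env (jscale c p) = jpoly_eval env p *~ c.
Proof.
elim: p => [|[d t] p IH] /=; first by rewrite mul0rz.
by rewrite IH mulrzDl mulrzA_C.
Qed.

Lemma jmon_eval_node env t u :
  jmon_eval env (jnode t u) = jmon_eval env t ∘ jmon_eval env u.
Proof. by rewrite /jnode; case: ifP => //= _; rewrite jmulC. Qed.

Lemma jpoly_eval_prod env p q :
  jpoly_eval env (jprod p q) = jpoly_eval env p ∘ jpoly_eval env q.
Proof.
elim: p => [|[c t] p IH] /=; first by rewrite jmul0l.
rewrite jpoly_eval_add IH jmulDl; congr (_ + _).
elim: q {IH} => [|[d u] q IH] /=; first by rewrite jmul0.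
by rewrite jmon_eval_node IH jmulDr jmulMzl jmulMzr jmulMzl -mulrzA mulrC.
Qed.

Lemma jexp_evalE env e : jexp_eval env e = jpoly_eval env (jnorm e).
Proof.
elim: e => [n||e1 IH1 e2 IH2|e IH|e IH n|e1 IH1 e2 IH2] //=.
- by rewrite addr0.
- by rewrite jpoly_eval_add IH1 IH2.
- by rewrite jpoly_eval_scale IH mulrNz.
- by rewrite jpoly_eval_scale IH pmulrn.
- by rewrite jpoly_eval_prod IH1 IH2.
Qed.

(** Cancelled monomials stay in the list with coefficient 0, so the test inspects coefficients
    instead of asking for an empty list. *)
Lemma jring_correct env e1 e2 :
  all (fun ct => ct.1 == 0) (jnorm (JAdd e1 (JOpp e2))) ->
  jexp_eval env e1 = jexp_eval env e2.
Proof.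
move=> z; apply/eqP; rewrite -subr_eq0; apply/eqP.
rewrite -[LHS]/(jexp_eval env (JAdd e1 (JOpp e2))) jexp_evalE.
elim: (jnorm _) z => [|[c t] p IH] //= /andP[/eqP-> /IH->].
by rewrite mulr0z addr0.
Qed.

Lemma eq_of_addB {V : zmodType} (n : nat) (u v x y : V) :
  u = v -> x = y + (u - v) *+ n -> x = y.
Proof. by move=> -> ->; rewrite subrr mul0rn addr0. Qed.

End Bilinearity.

(** * Reification and linear combinations of identities *)

Ltac jindex x env :=
  lazymatch env with
  | x :: _ => constr:(0%N)
  | _ :: ?env' => let n := jindex x env' in constr:(S n)
  end.

(** [jindex] fails on a new atom, and the match then backtracks to the second branch. *)
Ltac jinsert_atom x env :=
  match env with
  | _ => let _ := jindex x env in env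
  | _ => constr:(x :: env)
  end.

Ltac jatoms e env :=
  lazymatch e with
  | GRing.zero => env
  | GRing.add ?a ?b => let env' := jatoms a env in jatoms b env'
  | GRing.opp ?a => jatoms a env
  | GRing.natmul ?a _ => jatoms a env
  | jmul ?a ?b => let env' := jatoms a env in jatoms b env'
  | _ => jinsert_atom e env
  end.

Ltac jreify e env :=
  lazymatch e with
  | GRing.zero => constr:(J0)
  | GRing.add ?a ?b =>
    let u := jreify a env in let v := jreify b env in constr:(JAdd u v)
  | GRing.opp ?a => let u := jreify a env in constr:(JOpp u)
  | GRing.natmul ?a ?n => let u := jreify a env in constr:(JMuln u n)
  | jmul ?a ?b =>
    let u := jreify a env in let v := jreify b env in constr:(JMul u v)
  | _ => let n := jindex e env in constr:(JX n)
  end.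

(* Proves the equalities that follow from bilinearity and commutativity of the
   product alone, after expanding every U. *)
Ltac jring :=
  rewrite /jU;
  match goal with |- @eq ?T ?l ?r =>
    let env0 := jatoms l (@nil T) in
    let env := jatoms r env0 in
    let u := jreify l env in
    let v := jreify r env in
    refine (@jring_correct _ _ env u v _); vm_compute; reflexivity
  end.

(* Reduces a goal x = y to x = y + (u - v) *+ n, where H : u = v, so that jring
   can close a linear combination of instances of the Jordan identity. *)
Tactic Notation "jusing" constr(H) "times" constr(n) :=
  refine (eq_of_addB n _ _ _ _ H _).
Tactic Notation "jusing" constr(H) := jusing H times 1%N.

(** * Identities of Jordan algebras *)

Section Identities.
Set Implicit Arguments.
Unset Strict Implicit.
Variables (F : fieldType) (char_neq2 : 2%N \notin [pchar F]).
Variable A : jordanType F.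
Implicit Types (a b c d e x y z : A).

Lemma mulr2n_inj a b : a *+ 2 = b *+ 2 -> a = b.
Proof.
have n2 : (2%:R : F) != 0.
  by apply: contra char_neq2 => n2; rewrite inE /= n2.
by rewrite -!scaler_nat => /(scalerI n2).
Qed.

(** The Jordan identity at [a + c] minus that at [a - c] is twice its part odd in [c]; removing the
    cubic part, which is the identity at [c], leaves twice the linear part. *)
Lemma jordan_linear1 a b c :
  (((a ∘ c) ∘ b) ∘ a) *+ 2 + ((a ∘ a) ∘ b) ∘ c =
  ((a ∘ c) ∘ (b ∘ a)) *+ 2 + (a ∘ a) ∘ (b ∘ c).
Proof.
apply: mulr2n_inj.
jusing (jmul_jordan (a + c) b).
jusing (esym (jmul_jordan (a - c) b)).
jusing (esym (jmul_jordan c b)) times 2%N.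
jring.
Qed.

(** Polarisation of [jordan_linear1], which is quadratic in [a]. *)
Lemma jordan_linear a b c d :
  ((a ∘ c) ∘ b) ∘ d + ((a ∘ d) ∘ b) ∘ c + ((c ∘ d) ∘ b) ∘ a =
  (a ∘ c) ∘ (b ∘ d) + (a ∘ d) ∘ (b ∘ c) + (c ∘ d) ∘ (b ∘ a).
Proof.
apply: mulr2n_inj.
jusing (jordan_linear1 (a + d) b c).
jusing (esym (jordan_linear1 a b c)).
jusing (esym (jordan_linear1 d b c)).
jring.
Qed.

Lemma jpower_comm x z : x ∘ ((x ∘ x) ∘ z) = (x ∘ x) ∘ (x ∘ z).
Proof. by rewrite jmulC jmul_jordan (jmulC z). Qed.

(* In operator form, (L_{xy} + [L_x, L_y]) U_x = U_x (L_{xy} - [L_x, L_y]):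
   take the commutator of L_x with 2 U_{x,xy} = L_y U_x + U_x L_y, where
   U_{a,b} = L_a L_b + L_b L_a - L_{ab}. *)
Lemma jU_shift x y z :
  (x ∘ y) ∘ jU x z + x ∘ (y ∘ jU x z) - y ∘ (x ∘ jU x z) =
  jU x ((x ∘ y) ∘ z - x ∘ (y ∘ z) + y ∘ (x ∘ z)).
Proof.
have jU_sum w : y ∘ jU x w + jU x (y ∘ w) =
    ((x ∘ y) ∘ (x ∘ w) + x ∘ ((x ∘ y) ∘ w) - (x ∘ (x ∘ y)) ∘ w) *+ 2.
  jusing (esym (jordan_linear1 x w y)).
  jusing (jordan_linear x x y w) times 2%N.
  jring.
jusing (congr1 (jmul x) (jU_sum z)).
jusing (esym (jU_sum (x ∘ z))).
jusing (esym (jordan_linear1 x z (x ∘ y))).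
jusing (jpower_comm x (y ∘ z)).
jusing (congr1 (jmul y) (jpower_comm x z)).
jring.
Qed.

(** At [w = jU x y], [jmulU] and [jU_comm] produce the left side of [jU_shift] with [z = x ∘ y].
    Everything then lies under U_x, and [jordan_linear1] identifies the argument as U_y x^2. *)
Lemma jU_sqr x y : jU x y ∘ jU x y = jU x (jU y (x ∘ x)).
Proof.
have jmulU w : jU x y ∘ w = - jU x (y ∘ w) +
    ((x ∘ y) ∘ (x ∘ w) - y ∘ (x ∘ (x ∘ w)) + x ∘ (y ∘ (x ∘ w))) *+ 2.
  jusing (jordan_linear x x y w) times 2%N.
  jusing (esym (jordan_linear x y x w)).
  jring.
have jU_comm w : x ∘ jU x w = jU x (x ∘ w).
  by jusing (esym (jpower_comm x w)); jring.
rewrite jmulU (jU_comm y).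
jusing (jU_shift x y (x ∘ y)) times 2%N.
jusing (esym (congr1 (jU x) (jordan_linear1 x y y))).
jring.
Qed.

(** [jordan_linear] expresses multiplication by x^2 x^2 and by x^3 through L_x and L_{x^2}. These
    commute, and both sides become (2 L_x^2 - L_{x^2})^2 z. *)
Lemma jU_of_sqr x z : jU (x ∘ x) z = jU x (jU x z).
Proof.
jusing (esym (jordan_linear x (x ∘ x) x z)).
jusing (esym (jordan_linear x x x (x ∘ z))) times 2%N.
jusing (jpower_comm x (x ∘ z)) times 4%N.
jusing (congr1 (jmul x) (jpower_comm x z)) times 2%N.
jring.
Qed.

Lemma jsqr_mul a b : (a ∘ b) ∘ (a ∘ b) *+ 4 =
  a ∘ jU b a *+ 2 + jU a (b ∘ b) + jU b (a ∘ a).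
Proof.
jusing (esym (jordan_linear1 a b b)) times 2%N.
jring.
Qed.

Lemma jmulU_sym a b : a ∘ jU b a = b ∘ jU a b.
Proof.
jusing (jordan_linear1 a b b).
jusing (esym (jordan_linear1 b a a)).
jring.
Qed.

End Identities.

(** * Annihilators and ranges of U_e without nilpotents *)

Section NoNilpotents.
Set Implicit Arguments.
Unset Strict Implicit.
Variables (F : fieldType) (char_neq2 : 2%N \notin [pchar F]).
Variables (A : jordanType F) (hA : no_nilpotents A).
Implicit Types (a b c e : A) (S T : set A).

Lemma jsqr_eq0 a : a ∘ a = 0 -> a = 0.
Proof. exact: (@hA a 2%N isT). Qed.

Lemma jU0 a : jU a 0 = 0.
Proof. by jring. Qed.

Lemma jU_sqr_eq0C a b : jU a (b ∘ b) = 0 -> jU b (a ∘ a) = 0.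
Proof.
move=> ab0; apply: jsqr_eq0.
by rewrite jU_sqr // jU_of_sqr // ab0 !jU0.
Qed.

Lemma jU_sqr_sqr_eq0 a b : jU (a ∘ a) (b ∘ b) = 0 <-> jU b (a ∘ a) = 0.
Proof.
split=> [ab0 | /jU_sqr_eq0C ab0]; last by rewrite jU_of_sqr // ab0 jU0.
by apply: jsqr_eq0; rewrite jU_sqr // ab0 jU0.
Qed.

Lemma jU_idempotent_idem e c : jidempotent e -> jU e (jU e c) = jU e c.
Proof. by move=> ee; rewrite -jU_of_sqr // ee. Qed.

(** [J3] is the Peirce equation 2 L_e^3 - 3 L_e^2 + L_e = 0, and U_e = 2 L_e^2 - L_e. *)
Lemma jmul_jU_idempotent e c : jidempotent e -> e ∘ jU e c = jU e c.
Proof.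
move=> ee; have := jordan_linear char_neq2 e e e c; rewrite !ee => J3.
rewrite /jU ee; jusing J3; jring.
Qed.

Lemma jUrange_sqr e a : jidempotent e -> jUrange e a -> jUrange e (a ∘ a).
Proof.
by move=> ee [c _ <-]; exists (jU c e) => //; rewrite jU_sqr // ee.
Qed.

(* Writing f = 1 - e in the unital hull, (U_a f)^2 = U_a U_f a^2 = 0, so
   U_a e = a^2; this forces (a - e a)^2 = 0. *)
Lemma jUrange_of_sqr e a : jidempotent e -> jUrange e (a ∘ a) -> jUrange e a.
Proof.
move=> ee [c _ aaE].
have eaa : e ∘ (a ∘ a) = a ∘ a by rewrite -aaE jmul_jU_idempotent.
have Ueaa : jU e (a ∘ a) = a ∘ a by rewrite -aaE jU_idempotent_idem.
have Uaaa : jU a (a ∘ a) = (a ∘ a) ∘ (a ∘ a).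
  jusing (jpower_comm a a) times 2%N; jring.
have Uae : jU a e = a ∘ a.
  apply/eqP; rewrite -subr_eq0; apply/eqP/jsqr_eq0.
  (* Cross term of the square: L_{a^2} commutes with U_a, and multiplication by [e] fixes a^2. *)
  have UaeM : jU a e ∘ (a ∘ a) = (a ∘ a) ∘ (a ∘ a).
    rewrite -Uaaa -[X in _ = jU a X]eaa.
    jusing (esym (congr1 (jmul a) (jpower_comm a e))) times 2%N.
    jusing (esym (jpower_comm a (a ∘ e))) times 2%N.
    jring.
  have UaeS : jU a e ∘ jU a e = (a ∘ a) ∘ (a ∘ a).
    by rewrite jU_sqr // Ueaa Uaaa.
  by jusing UaeS; jusing (esym UaeM) times 2%N; jring.
have aea : a ∘ (e ∘ a) = a ∘ a.
  apply: (mulr2n_inj char_neq2).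
  by jusing Uae; jusing eaa; jring.
have eaS : (e ∘ a) ∘ (e ∘ a) = a ∘ a.
  (* [jsqr_mul] yields only 4 (e a)^2, whose three terms are here 2 a^2, a^2 and a^2. *)
  do 2!apply: (mulr2n_inj char_neq2).
  have aUea : a ∘ jU e a = a ∘ a by rewrite jmulU_sym // Uae.
  have := jsqr_mul char_neq2 e a.
  rewrite ee Ueaa -jmulU_sym // aUea Uae => eq4.
  by jusing eq4; jring.
have eaE : e ∘ a = a.
  apply/esym/eqP; rewrite -subr_eq0; apply/eqP/jsqr_eq0.
  by jusing eaS; jusing (esym aea) times 2%N; jring.
exists a => //; rewrite /jU jmulC ee !eaE mulr2n addrK //.
Qed.

Lemma lperp_posE S :
  lperp_pos S = rperp [set a ∘ a | a in S] `&` jsquares A.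
Proof.
apply/seteqP; split=> x [xS [b _ bbE]]; split; do ?by [exists b].
  move=> _ [a Sa <-]; rewrite -bbE; apply/jU_sqr_sqr_eq0.
  by rewrite bbE; apply: xS.
move=> a Sa; rewrite -bbE; apply/jU_sqr_sqr_eq0.
by rewrite bbE; apply: xS; exists a.
Qed.

Lemma rperp_sqrE T a :
  rperp [set b ∘ b | b in T] a <-> lperp_pos T (a ∘ a).
Proof.
split=> [aT | [aT _] _ [b Tb <-]]; last exact/jU_sqr_eq0C/aT.
split; last by exists a.
by move=> b Tb; apply/jU_sqr_eq0C/aT; exists b.
Qed.

End NoNilpotents.

Theorem theorem2p6 (F : fieldType) (char_neq2 : 2%N \notin [pchar F])
    (A : jordanType F) (hA : no_nilpotents A) :
  (forall S : set A, S `<=` jsquares A ->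
     exists2 e : A, jidempotent e & rperp S = jUrange e)
  <->
  (forall S : set A,
     exists2 e : A, jidempotent e & lperp_pos S = jUrange_pos e).
Proof.
split=> [A2 S | B2 S S_sq].
  have [|e ee eE] := A2 [set a ∘ a | a in S].
    by move=> _ [a _ <-]; exists a.
  by exists e => //; rewrite lperp_posE // eE.
(* (B2) is applied to the set of all square roots of elements of [S]; as [S] consists of squares,
   their squares give back [S]. *)
have SE : S = [set b ∘ b | b in [set b | S (b ∘ b)]].
  apply/seteqP; split=> [x Sx | _ [b Sb <-] //].
  by have [b _ bE] := S_sq x Sx; exists b; rewrite //= bE.
have [e ee eE] := B2 [set b | S (b ∘ b)].
exists e => //; rewrite {1}SE; apply/seteqP; split=> a.
  by move/(rperp_sqrE char_neq2 hA); rewrite eE => -[? _];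
    apply: jUrange_of_sqr.
move=> ea; apply/(rperp_sqrE char_neq2 hA); rewrite eE; split; last by exists a.
exact: jUrange_sqr.
Qed.
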